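(* (a) Let $\Gamma$ be an amenable group generated by a finite set $X$, and suppose that $\Gamma$ is recursively presentable. Then the Følner function $F_{\Gamma,X}\colon\mathbb N\to\mathbb N$ is subrecursive. (b) Let $(P_i)_{i\in\mathbb N}$, $P_i=\{\mathsf X_i\mid \mathsf R_i\}$, be an effective enumeration of all finitely generated recursive presentations, with associated groups $\Gamma_i:=\mathbb F_{\mathsf X_i}/\mathsf R_i^{\mathbb F_{\mathsf X_i}}$. For every recursively enumerable class $\mathcal C$ of finitely generated recursive presentations of amenable groups there exists a recursive function $U_{\mathcal C}\colon\mathbb N\to\mathbb N$ such that for every $P_i\in\mathcal C$ one has $F_{\Gamma_i,\mathsf X_i}(n)\le U_{\mathcal C}(n)$ for all sufficiently large $n$.
   Context: $\mathbb N$ denotes the positive integers. For a finite set $\mathsf X$, $\mathbb F_{\mathsf X}$ is the free group on $\mathsf X$; for $R\subset\mathbb F_{\mathsf X}$, $R^{\mathbb F_{\mathsf X}}$ is its normal closure. If $\Gamma$ is generated by a finite set $X$, fix a set $\mathsf X$ with a bijection $\mathsf X\to X$, and let $\pi_\Gamma\colon\mathbb F_{\mathsf X}\to\Gamma$ be the induced epimorphism. $\Gamma$ is recursively presentable if there is a recursive $R\subset\mathbb F_{\mathsf X}$ with $R^{\mathbb F_{\mathsf X}}=\ker\pi_\Gamma$. A non-empty finite $\Omega\subset\Gamma$ is an $n$-Følner set with respect to $X$ if $|\Omega\setminus x\Omega|/|\Omega|\le n^{-1}$ for all $x\in X$. The Følner function is $F_{\Gamma,X}(n):=\min\{|\Omega|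 : \Omega \text{ is an } n\text{-Følner set with respect to } X\}$, with $\min\emptyset:=\infty$. $\Gamma$ is amenable if $n$-Følner sets exist for every $n\in\mathbb N$. For a presentation $P_i$, $F_{\Gamma_i,\mathsf X_i}$ is the Følner function with respect to the images in $\Gamma_i$ of the generators $\mathsf X_i$. A function $\mathbb N\to\mathbb N$ is recursive if it is computed by an algorithm that halts on every input, and subrecursive if it is bounded above by a recursive function. A finitely generated recursive presentation is $\{\mathsf X\mid\mathsf R\}$ with $\mathsf X$ finite and $\mathsf R\subset\mathbb F_{\mathsf X}$ recursive. The enumeration $(P_i)$ is effective in the sense that from $i$ one can compute the finite set $\mathsf X_i$ and an algorithm enumerating $\mathsf R_i$. A class $\mathcal C$ of presentations is recursively enumerable if there is an algorithm listing indices $i$ such that the listed presentations $P_i$ are exactly the members of $\mathcal C$. *)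

(* Defs.v *)
From HB Require Import structures.
From mathcomp Require Import all_boot all_order all_algebra.
From mathcomp Require Import finmap generic_quotient.
From mathcomp Require Import boolp classical_sets.

Set Implicit Arguments.
Unset Strict Implicit.
Unset Printing Implicit Defensive.

Local Open Scope classical_set_scope.
Local Open Scope quotient_scope.
Local Open Scope group_scope.

(* Algorithms: Kleene's partial recursive functions, presented as unary
   functions on nat with several arguments packed by Cantor's pairing, a
   bijection nat * nat -> nat. *)

Definition cpair (a b : nat) : nat := ('C((a + b).+1, 2) + b)%N.

Inductive algo : Type :=
  | Zero | Succ | Left | Right
  | Pair of algo & algo
  | Comp of algo & algo
  | Prec of algo & algo
  | Mu of algo.

(* [eval c n m]: the algorithm c halts on the input n with output m. *)
Fixpoint eval (c : algo) (n m : nat) : Prop :=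
  match c with
  | Zero => m = 0%N
  | Succ => m = n.+1
  | Left => exists b, n = cpair m b
  | Right => exists a, n = cpair a m
  | Pair f g => exists a b, [/\ eval f n a, eval g n b & m = cpair a b]
  | Comp f g => exists2 k, eval g n k & eval f k m
  | Prec f g => exists a k (s : nat -> nat),
      [/\ n = cpair a k, eval f a (s 0%N),
          forall j, (j < k)%N -> eval g (cpair a (cpair j (s j))) (s j.+1)
        & m = s k]
  | Mu f => eval f (cpair n m) 0 /\
      forall j, (j < m)%N -> exists v, eval f (cpair n j) v.+1
  end.

Definition computes (c : algo) (f : nat -> nat) := forall n, eval c n (f n).

Definition recursive (f : nat -> nat) := exists c, computes c f.

Definition recursive_set (A : set nat) := recursive (fun n => `[< A n >] : nat).

(* c halts everywhere and, run on 0, 1, 2, ..., lists A: the output a.+1 at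
   stage t prints a, the output 0 prints nothing.  A may be empty. *)
Definition lists (c : algo) (A : set nat) :=
  exists2 f, computes c f & forall a, A a <-> exists t, f t = a.+1.

Fixpoint godel (c : algo) : nat :=
  match c with
  | Zero => cpair 0 0
  | Succ => cpair 1 0
  | Left => cpair 2 0
  | Right => cpair 3 0
  | Pair f g => cpair 4 (cpair (godel f) (godel g))
  | Comp f g => cpair 5 (cpair (godel f) (godel g))
  | Prec f g => cpair 6 (cpair (godel f) (godel g))
  | Mu f => cpair 7 (godel f)
  end.

(* The free group on 'I_k, as the set of reduced words; the letter (j, true)
   is the generator j, and (j, false) its inverse. *)

Section FreeGroup.
Variable k : nat.

Notation letter := ('I_k * bool)%type.

Definition linv (a : letter) : letter := (a.1, ~~ a.2).

Definition reduced (w : seq letter) := sorted (fun a b => b != linv a) w.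

Record freegroup := FreeGroup {fgword :> seq letter; _ : reduced fgword}.

HB.instance Definition _ := [isSub for fgword].
HB.instance Definition _ := [Choice of freegroup by <:].

Definition lcons (a : letter) (w : seq letter) :=
  if w is b :: w' then if b == linv a then w' else a :: w else [:: a].

(* Free reduction of u ++ w, for w reduced. *)
Definition lcat (u w : seq letter) := foldr lcons w u.

Lemma linvK : involutive linv.
Proof. by case=> j b; rewrite /linv negbK. Qed.

Lemma reduced_behead a w : reduced (a :: w) -> reduced w.
Proof. by case: w => //= b w /andP[]. Qed.

Lemma reduced_lcons a w : reduced w -> reduced (lcons a w).
Proof.
case: w => //= b w rw; case: ifP => [_|/negbT nb]; last by rewrite /= nb.
exact: reduced_behead rw.
Qed.

Lemma lconsVK a w : reduced w -> lcons (linv a) (lcons a w) = w.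
Proof.
case: w => [|b w] /=; first by rewrite linvK eqxx.
case: ifP => [/eqP-> | _ _]; last by rewrite /= linvK eqxx.
by case: w => //= c w; rewrite linvK => /andP[/negbTE-> _].
Qed.

Lemma lconsKV a w : reduced w -> lcons a (lcons (linv a) w) = w.
Proof. by move=> rw; rewrite -{1}[a]linvK lconsVK. Qed.

Lemma reduced_lcat u w : reduced w -> reduced (lcat u w).
Proof. by move=> rw; elim: u => //= a u; exact: reduced_lcons. Qed.

Lemma lcat_lcons a u w : reduced w -> lcat (lcons a u) w = lcons a (lcat u w).
Proof.
move=> rw; case: u => //= b u; case: ifP => //= /eqP->.
by rewrite lconsKV // reduced_lcat.
Qed.

Lemma lcatA u v w : reduced w -> lcat u (lcat v w) = lcat (lcat u v) w.
Proof. by move=> rw; elim: u => //= a u ->; rewrite lcat_lcons. Qed.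

Lemma lcat_nil u : reduced u -> lcat u [::] = u.
Proof.
elim: u => //= a u IHu ru; rewrite IHu; last exact: reduced_behead ru.
by case: u ru {IHu} => //= b u /andP[/negbTE->].
Qed.

Definition winv (u : seq letter) := rev (map linv u).

Lemma reduced_winv u : reduced u -> reduced (winv u).
Proof.
rewrite /reduced /winv rev_sorted; case: u => //= a u.
rewrite path_map; apply: sub_path => b c /=.
by rewrite linvK eq_sym.
Qed.

Lemma winvK u : winv (winv u) = u.
Proof. by rewrite /winv map_rev revK mapK //; exact: linvK. Qed.

Lemma lcat_winv u : lcat (winv u) u = [::].
Proof.
elim: u => //= a u; rewrite /winv /= rev_cons /lcat foldr_rcons /= linvK eqxx.
exact.
Qed.

Definition fgone := @FreeGroup [::] isT.
Definition fgmul (u v : freegroup) := FreeGroup (reduced_lcat u (valP v)).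
Definition fginv (u : freegroup) := FreeGroup (reduced_winv (valP u)).

Lemma fgmulA : associative fgmul.
Proof. by move=> u v w; apply: val_inj; rewrite /= lcatA //; exact: valP. Qed.

Lemma fgmul1 : right_id fgone fgmul.
Proof. by move=> u; apply: val_inj; rewrite /= lcat_nil //; exact: valP. Qed.

Lemma fg1mul : left_id fgone fgmul.
Proof. by move=> u; apply: val_inj. Qed.

Lemma fgVmul : left_inverse fgone fginv fgmul.
Proof. by move=> u; apply: val_inj; exact: lcat_winv. Qed.

Lemma fgmulV : right_inverse fgone fginv fgmul.
Proof. by move=> u; apply: val_inj; rewrite /= -{1}[val u]winvK lcat_winv. Qed.

HB.instance Definition _ :=
  isGroup.Build freegroup fgmulA fg1mul fgmul1 fgVmul fgmulV.

Definition fggen (j : 'I_k) : freegroup := @FreeGroup [:: (j, true)] isT.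

(* Letters are coded by 2 j and 2 j + 1, and lists by [::] |-> 0 and
   a :: s |-> <a, s> + 1. *)
Definition fgcode (w : freegroup) : nat :=
  foldr (fun (a : letter) c => (cpair (a.1.*2 + a.2) c).+1) 0%N w.

(* The homomorphism to G that maps the generator j to x j. *)
Definition fglift (G : groupType) (x : 'I_k -> G) (w : freegroup) : G :=
  foldr (fun (a : letter) g => (if a.2 then x a.1 else (x a.1)^-1) * g) 1 w.

Definition recursive_subset (R : set freegroup) := recursive_set (fgcode @` R).

End FreeGroup.

Section Subgroups.
Variable G : groupType.

Definition subgroup (N : set G) :=
  [/\ N 1, forall u v, N u -> N v -> N (u * v) & forall u, N u -> N u^-1].

Definition normal_subgroup (N : set G) :=
  subgroup N /\ forall u v, N u -> N (u ^ v).

Definition generates (X : set G) := smallest subgroup X = setT.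

Definition normal_closure (R : set G) : set G := smallest normal_subgroup R.

Lemma normal_closureP R : normal_subgroup (normal_closure R).
Proof.
split; first split.
- by move=> N [[[]]].
- by move=> u v Nu Nv N NR; case: (NR) => -[[_ M _] _] _; apply: M;
    [exact: Nu | exact: Nv].
- by move=> u Nu N NR; case: (NR) => -[[_ _ M] _] _; apply: M; exact: Nu.
- by move=> u v Nu N NR; case: (NR) => -[_ M] _; apply: M; exact: Nu.
Qed.

End Subgroups.

Section QuotientGroup.
Variables (G : groupType) (R : set G).

Definition nceq (u v : G) : bool := `[< normal_closure R (u^-1 * v) >].

Lemma nceq_equiv : equiv_class_of nceq.
Proof.
have [[N1 NM NV] _] := normal_closureP R.
split=> [u | u v | v u w].
- by apply/asboolP; rewrite mulVg.
- by apply/asboolP/asboolP => /NV; rewrite invgM invgK.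
- move=> /asboolP uv /asboolP vw; apply/asboolP.
  by have := NM _ _ uv vw; rewrite mulgA mulgK.
Qed.

Canonical nceq_rel := EquivRelPack nceq_equiv.

(* G modulo the normal closure of R. *)
Definition ncquot := {eq_quot nceq}.

HB.instance Definition _ := Choice.on ncquot.
HB.instance Definition _ := EqQuotient.on ncquot.

Definition ncpi (u : G) : ncquot := \pi_ncquot u.

Lemma ncpiP u v : ncpi u = ncpi v <-> normal_closure R (u^-1 * v).
Proof. by split=> [/eqquotP/asboolP | ?]; last by apply/eqquotP/asboolP. Qed.

Lemma ncreprK (a : ncquot) : ncpi (repr a) = a.
Proof. exact: reprK. Qed.

Lemma ncpi_reprl u v : ncpi (repr (ncpi u) * v) = ncpi (u * v).
Proof.
have [_ NJ] := normal_closureP R.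
apply/ncpiP; have /ncpiP/(NJ _ v) := ncreprK (ncpi u).
by rewrite conjgE invgM !mulgA.
Qed.

Lemma ncpi_reprr u v : ncpi (u * repr (ncpi v)) = ncpi (u * v).
Proof.
apply/ncpiP; have /ncpiP := ncreprK (ncpi v).
by rewrite invgM !mulgA mulgVK.
Qed.

Lemma ncpi_inv u : ncpi (repr (ncpi u))^-1 = ncpi u^-1.
Proof.
have [[_ _ NV] NJ] := normal_closureP R.
apply/ncpiP; rewrite invgK; have /ncpiP/NV/(NJ _ u^-1) := ncreprK (ncpi u).
by rewrite conjgE invgM !invgK -!mulgA mulVKg.
Qed.

Definition ncone : ncquot := ncpi 1.
Definition ncmul (a b : ncquot) : ncquot := ncpi (repr a * repr b).
Definition ncinv (a : ncquot) : ncquot := ncpi (repr a)^-1.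

Lemma ncmulE u v : ncmul (ncpi u) (ncpi v) = ncpi (u * v).
Proof. by rewrite /ncmul ncpi_reprl ncpi_reprr. Qed.

Lemma ncmulA : associative ncmul.
Proof.
move=> a b c; rewrite -[a]ncreprK -[b]ncreprK -[c]ncreprK.
by rewrite !ncmulE mulgA.
Qed.

Lemma nc1mul : left_id ncone ncmul.
Proof. by move=> a; rewrite -[a]ncreprK ncmulE mul1g. Qed.

Lemma ncmul1 : right_id ncone ncmul.
Proof. by move=> a; rewrite -[a]ncreprK ncmulE mulg1. Qed.

Lemma ncVmul : left_inverse ncone ncinv ncmul.
Proof.
by move=> a; rewrite -[a]ncreprK /ncinv ncpi_inv ncmulE mulVg.
Qed.

Lemma ncmulV : right_inverse ncone ncinv ncmul.
Proof.
by move=> a; rewrite -[a]ncreprK /ncinv ncpi_inv ncmulE mulgV.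
Qed.

HB.instance Definition _ :=
  isGroup.Build ncquot ncmulA nc1mul ncmul1 ncVmul ncmulV.

End QuotientGroup.

Section Folner.
Variables (G : groupType) (X : {fset G}).
Local Open Scope fset_scope.

Definition translate (x : G) (A : {fset G}) : {fset G} :=
  [fset (x * g)%g | g in A].

Definition folner_set (n : nat) (A : {fset G}) : Prop :=
  A != fset0 /\
  forall x, x \in X ->
    (#|` A `\` translate x A|%:R / #|` A|%:R <= n%:R^-1 :> rat)%R.

Definition amenable : Prop :=
  forall n, (0 < n)%N -> exists A, folner_set n A.

Definition folner_card (n m : nat) : bool :=
  `[< exists2 A, folner_set n A & #|` A| = m >].

(* None stands for the value infinity; only arguments n > 0 are meaningful. *)
Definition folner_fun (n : nat) : option nat :=
  if pselect (exists m, folner_card n m) is left e then Some (ex_minn e)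
  else None.

End Folner.

Definition le_fin (a : option nat) (b : nat) : Prop :=
  if a is Some m then (m <= b)%N else False.

Definition subrecursive (F : nat -> option nat) : Prop :=
  exists2 g, recursive g & forall n, (0 < n)%N -> le_fin (F n) (g n).

(* x is the bijection from the set of symbols 'I_k onto the generating set. *)
Definition recursively_presentable (G : groupType) (k : nat) (x : 'I_k -> G) :=
  exists2 R : set (freegroup k), recursive_subset R
    & normal_closure R = [set w | fglift x w = 1].

Record presentation := Presentation {
  ngen : nat;
  relators : set (freegroup ngen);
  relators_recursive : recursive_subset relators }.

Definition pgroup (P : presentation) : groupType := ncquot (@relators P).

Definition pgens (P : presentation) : {fset pgroup P} :=
  [fset ncpi (@relators P) (fggen j) | j in 'I_(ngen P)]%fset.

(* e computes from i (the Goedel number of) an algorithm listing the relators. *)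
Definition effective_enumeration (P : nat -> presentation) : Prop :=
  [/\ forall Q, exists i, P i = Q,
      recursive (fun i => ngen (P i))
    & exists2 e, recursive e &
        forall i, exists2 c, godel c = e i
                           & lists c (@fgcode _ @` @relators (P i)) ].

Definition recursively_enumerable (P : nat -> presentation)
    (C : set presentation) : Prop :=
  exists2 A : set nat, (exists c, lists c A) & C = P @` A.

(* Main.v *)
(* A group equality between words is witnessed by a finite derivation, whereas
   an inequality is not; so one cannot search for a Folner set by enumerating
   finite sets of words, whose images might collapse.  Instead one searches for
   m words, possibly equal in the group, and for each generator x_j a partial
   matching of their indices along w_s = x_j w_t, certified by derivations, that
   misses at most m / ((n + 1)(k + 1)) indices.  The multiplicity function on
   the group then has small variation, and by the layer-cake formula one of its
   level sets is Folner; it has at most m elements.  Conversely a Folner set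
   provides such data, so the search succeeds in an amenable group.

   For (b) the search must be uniform in the presentation: its relators are
   listed by an algorithm known through its Goedel number, which requires the
   evaluation relation to be recursively enumerable.  Both this relation and the
   word problem are least fixed points of Horn clauses with at most two
   premises, and those are recursively enumerable.  U n then dominates the bounds
   found at n for the presentations listed before stage n. *)

Require Import Defs.
From mathcomp Require Import all_boot all_order all_algebra.
From mathcomp Require Import finmap boolp classical_sets.
From mathcomp Require Import zify.

Set Implicit Arguments.
Unset Strict Implicit.
Unset Printing Implicit Defensive.

(** * Cantor's pairing and the determinism of evaluation *)

Lemma cpairSl a b : cpair a b.+1 = (cpair a.+1 b).+1.
Proof. by rewrite /cpair addSnnS addnS. Qed.

Lemma cpairS0 b : cpair b.+1 0 = (cpair 0 b).+1.
Proof. by rewrite /cpair !addn0 add0n binS bin1 addnS. Qed.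

(** Successive codes walk along the antidiagonals: [(a.+1, b)] is followed by [(a, b.+1)], and
    [(0, b)] by [(b.+1, 0)]. *)
Lemma cpair_surj n : exists ab : nat * nat, n = cpair ab.1 ab.2.
Proof.
elim: n => [|n [[[|a] b] /= ->]]; first by exists (0, 0).
- by exists (b.+1, 0); rewrite cpairS0.
- by exists (a, b.+1); rewrite cpairSl.
Qed.

Lemma cpair_inj a b a' b' : cpair a b = cpair a' b' -> a = a' /\ b = b'.
Proof.
(* Each antidiagonal is coded entirely below the next one, so the code determines the sum of the
   components. *)
have lt_cpair c d c' d' : c + d < c' + d' -> cpair c d < cpair c' d'.
  move=> lt_s; apply: (@leq_trans 'C((c + d).+2, 2)).
    by rewrite [leqRHS]binS bin1 /cpair; lia.
  by apply: leq_trans (leq_addr _ _); apply: leq_bin2l.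
case: (ltngtP (a + b) (a' + b')) => [/lt_cpair|/lt_cpair|eq_s].
- by move=> + eqc; rewrite eqc ltnn.
- by move=> + eqc; rewrite eqc ltnn.
- by rewrite /cpair eq_s => /addnI eqb; split=> //; lia.
Qed.

Lemma leq_cpair a b : b <= cpair a b.
Proof. exact: leq_addl. Qed.

(* Otherwise [done] evaluates the pairing at the tags of [godel]. *)
Local Opaque cpair.

Definition unpair n := sval (cid (cpair_surj n)).
Definition p1 n := (unpair n).1.
Definition p2 n := (unpair n).2.

Lemma p12K n : cpair (p1 n) (p2 n) = n.
Proof. by rewrite /p1 /p2 -(svalP (cid (cpair_surj n))). Qed.

Lemma p1K a b : p1 (cpair a b) = a.
Proof. by have [] := cpair_inj (p12K (cpair a b)). Qed.

Lemma p2K a b : p2 (cpair a b) = b.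
Proof. by have [] := cpair_inj (p12K (cpair a b)). Qed.

(** In the case of [Mu], the smaller of two distinct results would give [f] both a zero and a
    positive value; in the case of [Prec], the two value sequences agree by induction. *)
Lemma eval_fun c n m m' : eval c n m -> eval c n m' -> m = m'.
Proof.
elim: c n m m' => [||||f IHf g IHg|f IHf g IHg|f IHf g IHg|f IHf] n m m' /=.
- by move=> -> ->.
- by move=> -> ->.
- by move=> [b ->] [b' /cpair_inj[]].
- by move=> [b ->] [b' /cpair_inj[]].
- by move=> [a [b [fa gb ->]]] [a' [b' [/(IHf _ _ _ fa)-> /(IHg _ _ _ gb)-> ->]]].
- by move=> [k gk fm] [k' /(IHg _ _ _ gk)<-]; apply: IHf.
- move=> [a [k [s [-> s0 sS ->]]]] [a' [k' [s' [/cpair_inj[<- <-] s0' sS' ->]]]].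
  suff eq_s j : j <= k -> s j = s' j by exact: eq_s.
  elim: j => [|j IHj] lt_jk; first exact: IHf s0 s0'.
  by apply: IHg (sS j lt_jk) _; rewrite IHj ?(ltnW lt_jk) //; exact: sS'.
- move=> [fm lt_m] [fm' lt_m']; case: (ltngtP m m') => // [/lt_m'|/lt_m] [v fv].
  + by have := IHf _ _ _ fm fv.
  + by have := IHf _ _ _ fm' fv.
Qed.

Lemma computesP c f : computes c f -> forall n m, eval c n m <-> f n = m.
Proof.
by move=> cf n m; split=> [/(eval_fun (cf n)) | <-].
Qed.

(** * Recursive functions *)

Lemma recursive_id : recursive (fun n => n).
Proof.
exists (Pair Left Right) => n /=; exists (p1 n), (p2 n); rewrite p12K; split=> //.
- by exists (p2 n); rewrite p12K.
- by exists (p1 n); rewrite p12K.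
Qed.

Lemma recursive_comp f g :
  recursive f -> recursive g -> recursive (fun n => f (g n)).
Proof. by move=> [c cf] [d dg]; exists (Comp c d) => n /=; exists (g n). Qed.

Lemma recursive_S f : recursive f -> recursive (fun n => (f n).+1).
Proof. by apply: recursive_comp; exists Succ. Qed.

Lemma recursive_const m : recursive (fun=> m).
Proof. by elim: m => [|m /recursive_S//]; exists Zero. Qed.

Lemma recursive_p1 f : recursive f -> recursive (fun n => p1 (f n)).
Proof.
apply: recursive_comp; exists Left => n.
by exists (p2 n); rewrite p12K.
Qed.

Lemma recursive_p2 f : recursive f -> recursive (fun n => p2 (f n)).
Proof.
apply: recursive_comp; exists Right => n.
by exists (p1 n); rewrite p12K.
Qed.

Lemma recursive_cpair f g : recursive f -> recursive g ->
  recursive (fun n => cpair (f n) (g n)).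
Proof.
by move=> [c cf] [d dg]; exists (Pair c d) => n /=; exists (f n), (g n).
Qed.

Lemma recursive_nat_rec s b (h : nat -> nat -> nat -> nat) :
  recursive s -> recursive b ->
  recursive (fun z => h (p1 z) (p1 (p2 z)) (p2 (p2 z))) ->
  recursive (fun n => nat_rec (fun=> nat) (b n) (h n) (s n)).
Proof.
move=> rs [c cb] [d dh].
(* [Prec] recurses on the second component of its argument, so the bound is first freed from its
   dependence on [n]. *)
suff rP : recursive (fun z => nat_rec (fun=> nat) (b (p1 z)) (h (p1 z)) (p2 z)).
  have := recursive_comp rP (recursive_cpair recursive_id rs).
  by congr recursive; apply: funext => n; rewrite p1K p2K.
exists (Prec c d) => z /=; exists (p1 z), (p2 z).
exists (nat_rec (fun=> nat) (b (p1 z)) (h (p1 z))).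
split=> //; first by rewrite p12K.
by move=> j _; have := dh (cpair (p1 z)
  (cpair j (nat_rec (fun=> nat) (b (p1 z)) (h (p1 z)) j))); rewrite !(p1K, p2K).
Qed.

Lemma recursive_iter s (g b : nat -> nat) :
  recursive s -> recursive g -> recursive b ->
  recursive (fun n => iter (s n) g (b n)).
Proof.
move=> rs rg rb.
have := @recursive_nat_rec s b (fun _ _ => g) rs rb.
have -> : (fun n => nat_rec (fun=> nat) (b n) (fun=> g) (s n)) =
  (fun n => iter (s n) g (b n)).
  by apply: funext => n; elim: (s n) => //= k ->.
by apply; apply: recursive_comp rg _; do !apply: recursive_p2; exact: recursive_id.
Qed.

Lemma recursive_addn f g : recursive f -> recursive g ->
  recursive (fun n => f n + g n).
Proof.
move=> rf rg; have := recursive_iter rf (recursive_S recursive_id) rg.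
by congr recursive; apply: funext => n; rewrite iter_succn addnC.
Qed.

Lemma recursive_pred f : recursive f -> recursive (fun n => (f n).-1).
Proof.
move=> rf.
have := @recursive_nat_rec f (fun=> 0) (fun _ j _ => j) rf (recursive_const 0).
have -> : (fun n => nat_rec (fun=> nat) 0 (fun j _ => j) (f n)) = fun n => (f n).-1.
  by apply: funext => n; case: (f n).
by apply; apply: recursive_p1; apply: recursive_p2; exact: recursive_id.
Qed.

Lemma recursive_subn f g : recursive f -> recursive g ->
  recursive (fun n => f n - g n).
Proof.
move=> rf rg; have := recursive_iter rg (recursive_pred recursive_id) rf.
by congr recursive; apply: funext => n; rewrite iter_predn.
Qed.

Lemma recursive_sum (s : nat -> nat) (F : nat -> nat -> nat) :
  recursive s -> recursive (fun z => F (p1 z) (p2 z)) ->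
  recursive (fun n => \sum_(j < s n) F n j).
Proof.
move=> rs rF.
have := @recursive_nat_rec s (fun=> 0) (fun n j v => F n j + v) rs (recursive_const 0).
have -> : (fun n => nat_rec (fun=> nat) 0 (fun j v => F n j + v) (s n)) =
          fun n => \sum_(j < s n) F n j.
  apply: funext => n; elim: (s n) => [|k /= ->]; first by rewrite big_ord0.
  by rewrite big_ord_recr addnC.
apply; apply: recursive_addn.
  have rid := recursive_id.
  have := recursive_comp rF (recursive_cpair (recursive_p1 rid)
    (recursive_p1 (recursive_p2 rid))).
  by congr recursive; apply: funext => n; rewrite p1K p2K.
by do !apply: recursive_p2; exact: recursive_id.
Qed.

Lemma recursive_muln f g : recursive f -> recursive g ->
  recursive (fun n => f n * g n).
Proof.
move=> rf rg.
have := @recursive_sum f (fun n _ => g n) rf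
  (recursive_comp rg (recursive_p1 recursive_id)).
by congr recursive; apply: funext => n; rewrite sum_nat_const card_ord.
Qed.

(** * Finite lists coded by numbers, in the same way as in [fgcode] *)

Definition lcode (s : seq nat) : nat := foldr (fun a c => (cpair a c).+1) 0 s.

Definition ltail n := p2 n.-1.
Definition ldrop i n := iter i ltail n.
Definition lnth n i := p1 (ldrop i n).-1.

(** This lets a search over numbers range over all finite lists. The induction is well founded since
    a pair is coded no lower than its second component. *)
Lemma lcode_surj n : exists s, n = lcode s.
Proof.
elim/ltn_ind: n => -[_|n IHn]; first by exists [::].
have [|s eqs] := IHn (p2 n); first by rewrite -{2}[n]p12K ltnS leq_cpair.
by exists (p1 n :: s); rewrite /= -eqs p12K.
Qed.

Lemma lcode_inj : injective lcode.
Proof. by elim=> [|a s IHs] [|b t] //= [/cpair_inj[-> /IHs->]]. Qed.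

Lemma ldrop_lcode i s : ldrop i (lcode s) = lcode (drop i s).
Proof.
(* The number 0 codes both the empty list and the pair [(0, 0)], so dropping past the end stays at
   the empty list. *)
have p20 : p2 0 = 0 by exact: (p2K 0 0).
elim: i s => [|i IHi] s; first by rewrite drop0.
rewrite /ldrop iterSr -/(ldrop _ _); case: s => [|a s] /=.
  by rewrite /ltail p20 -[0]/(lcode [::]) IHi.
by rewrite /ltail p2K IHi.
Qed.

Lemma lnth_lcode s i : lnth (lcode s) i = nth 0 s i.
Proof.
rewrite /lnth ldrop_lcode; elim: s i => [|a s IHs] [|i] //=; try exact: (p1K 0 0).
by rewrite p1K.
Qed.

Lemma lnth_mkseq (f : nat -> nat) k : exists L, forall i, i < k -> lnth L i = f i.
Proof. by exists (lcode (mkseq f k)) => i ltik; rewrite lnth_lcode nth_mkseq. Qed.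

Lemma recursive_ldrop f g : recursive f -> recursive g ->
  recursive (fun n => ldrop (f n) (g n)).
Proof.
move=> rf rg; apply: (recursive_iter rf) rg.
by apply: recursive_p2; apply: recursive_pred; exact: recursive_id.
Qed.

Lemma recursive_lnth f g : recursive f -> recursive g ->
  recursive (fun n => lnth (f n) (g n)).
Proof.
by move=> rf rg; apply: recursive_p1; apply: recursive_pred; exact: recursive_ldrop.
Qed.

(** * Recursively enumerable predicates *)

(** Testing for a zero turns conjunction into a sum, disjunction into a product and bounded
    universal quantification into a finite sum. *)
Definition re (S : nat -> Prop) :=
  exists2 f, recursive f & forall n, S n <-> exists t, f (cpair n t) = 0.

Lemma eq_re (S S' : nat -> Prop) : (forall n, S n <-> S' n) -> re S -> re S'.
Proof. by move=> eqS; rewrite (_ : S = S') //; apply: funext => n; apply: propext. Qed.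

Ltac rec_step := cbv beta; lazymatch goal with
  | |- recursive (fun z => z) => exact: recursive_id
  | |- recursive (fun=> ?m) => exact: recursive_const
  | |- recursive p1 => exact: (recursive_p1 recursive_id)
  | |- recursive p2 => exact: (recursive_p2 recursive_id)
  | |- recursive (fun z => _.+1) => apply: recursive_S
  | |- recursive (fun z => _.-1) => apply: recursive_pred
  | |- recursive (fun z => p1 _) => apply: recursive_p1
  | |- recursive (fun z => p2 _) => apply: recursive_p2
  | |- recursive (fun z => cpair _ _) => apply: recursive_cpair
  | |- recursive (fun z => addn _ _) => apply: recursive_addn
  | |- recursive (fun z => subn _ _) => apply: recursive_subn
  | |- recursive (fun z => muln _ _) => apply: recursive_muln
  | |- recursive (fun z => ldrop _ _) => apply: recursive_ldrop
  | |- recursive (fun z => lnth _ _) => apply: recursive_lnth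
  | H : recursive ?f |- recursive (fun z => ?f _) => apply: (recursive_comp H)
  | H : recursive ?f |- recursive ?f => exact: H
  end.
Ltac rec_tac := do ?rec_step.

Lemma re_eq f g : recursive f -> recursive g -> re (fun n => f n = g n).
Proof.
move=> rf rg; exists (fun z => (f (p1 z) - g (p1 z)) + (g (p1 z) - f (p1 z))).
  by rec_tac.
move=> n; split=> [eq_n|[t]]; last by rewrite p1K; lia.
by exists 0; rewrite p1K eq_n subnn.
Qed.

Lemma re_comp S f : re S -> recursive f -> re (fun n => S (f n)).
Proof.
move=> [h rh Sh] rf; exists (fun z => h (cpair (f (p1 z)) (p2 z))); first by rec_tac.
by move=> n; rewrite Sh; split=> -[t ht]; exists t; move: ht; rewrite p1K p2K.
Qed.

Lemma re_leq f g : recursive f -> recursive g -> re (fun n => f n <= g n).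
Proof.
move=> rf rg; apply: eq_re (@re_eq (fun n => f n - g n) (fun=> 0) _ _); try rec_tac.
by move=> n; rewrite -subn_eq0; split=> /eqP.
Qed.

Lemma re_and S S' : re S -> re S' -> re (fun n => S n /\ S' n).
Proof.
move=> [f rf Sf] [g rg Sg].
exists (fun z => f (cpair (p1 z) (p1 (p2 z))) + g (cpair (p1 z) (p2 (p2 z)))).
  by rec_tac.
move=> n; rewrite Sf Sg; split=> [[[t ft] [u gu]]|[t]].
  by exists (cpair t u); rewrite !(p1K, p2K) ft gu.
rewrite !(p1K, p2K) => /eqP; rewrite addn_eq0 => /andP[/eqP ft /eqP gt].
by split; [exists (p1 t) | exists (p2 t)].
Qed.

Lemma re_or S S' : re S -> re S' -> re (fun n => S n \/ S' n).
Proof.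
move=> [f rf Sf] [g rg Sg]; exists (fun z => f z * g z); first by rec_tac.
move=> n; rewrite Sf Sg; split=> [[[t ft]|[t gt]]|[t /eqP]].
- by exists t; rewrite ft.
- by exists t; rewrite gt muln0.
- by rewrite muln_eq0 => /orP[]/eqP; [left | right]; exists t.
Qed.

Lemma re_ex (S : nat -> nat -> Prop) :
  re (fun z => S (p1 z) (p2 z)) -> re (fun n => exists m, S n m).
Proof.
move=> [f rf Sf]; exists (fun z => f (cpair (cpair (p1 z) (p1 (p2 z))) (p2 (p2 z)))).
  by rec_tac.
move=> n; split=> [[m]|[t]].
  have := Sf (cpair n m); rewrite p1K p2K => -> [t ft].
  by exists (cpair m t); rewrite !(p1K, p2K).
rewrite !(p1K, p2K) => ft; exists (p1 t).
by have := Sf (cpair n (p1 t)); rewrite p1K p2K => ->; exists (p2 t).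
Qed.

(* One number codes the finite list of the witnesses of all j < s n. *)
Lemma re_ball s (S : nat -> nat -> Prop) : recursive s ->
  re (fun z => S (p1 z) (p2 z)) -> re (fun n => forall j, j < s n -> S n j).
Proof.
move=> rs [f rf Sf].
have {}Sf n j : S n j <-> exists t, f (cpair (cpair n j) t) = 0.
  by rewrite -Sf p1K p2K.
pose F z j := f (cpair (cpair (p1 z) j) (lnth (p2 z) j)).
exists (fun z => \sum_(j < s (p1 z)) F z j).
  apply: (recursive_sum (s := fun z => s (p1 z)) (F := F)); first by rec_tac.
  by rewrite /F; rec_tac.
move=> n; rewrite /F; split=> [Sn|[L]].
  have /choice[w Pw] j : exists t, j < s n -> f (cpair (cpair n j) t) = 0.
    have [/Sn/Sf[t]|] := boolP (j < s n); first by exists t.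
    by exists 0.
  have [L eqL] := lnth_mkseq w (s n); exists L.
  by rewrite p1K p2K big1 // => -[j ltj] _; rewrite /= eqL // Pw.
rewrite p1K p2K => /eqP; rewrite sum_nat_eq0 => /forallP ft j ltj.
by apply/Sf; exists (lnth L j); apply/eqP; exact: (ft (Ordinal ltj)).
Qed.

(** One unbounded search finds a code of both a value [m] and a witness of [S n m]; it halts by
    totality, and the first component of its result is the selected value. *)
Lemma re_select (S : nat -> nat -> Prop) :
  re (fun z => S (p1 z) (p2 z)) -> (forall n, exists m, S n m) ->
  exists2 g, recursive g & forall n, S n (g n).
Proof.
move=> [f rf Sf] exS.
pose h z := f (cpair (cpair (p1 z) (p1 (p2 z))) (p2 (p2 z))).
have exh n : exists t, h (cpair n t) == 0.
  have [m] := exS n; have := Sf (cpair n m); rewrite p1K p2K => -> [t ft].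
  by exists (cpair m t); rewrite /h !(p1K, p2K) ft.
have [c ch] : recursive h by rewrite /h; rec_tac.
have [d Pd] : recursive (fun n => ex_minn (exh n)).
  exists (Mu c) => n /=; case: ex_minnP => m /eqP hm min_m; split; first by rewrite -hm.
  move=> j ltjm; exists (h (cpair n j)).-1; rewrite prednK; first exact: ch.
  by rewrite lt0n; apply/negP => /min_m; rewrite leqNgt ltjm.
exists (fun n => p1 (ex_minn (exh n))); first by apply: recursive_p1; exists d.
move=> n; case: ex_minnP => m /eqP + _; rewrite /h !(p1K, p2K) => ft.
have := Sf (cpair n (p1 m)); rewrite p1K p2K => ->; first by exists (p2 m).
Qed.

Ltac re_step := cbv beta; lazymatch goal with
  | |- re (fun z => _ = _ :> nat) => apply: re_eq
  | |- re (fun z => is_true (leq _ _)) => apply: re_leq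
  | |- re (fun z => _ /\ _) => apply: re_and
  | |- re (fun z => _ \/ _) => apply: re_or
  | |- re (fun z => exists m : nat, _) => apply: re_ex
  | |- re (fun z => forall j : nat, is_true (leq (S j) _) -> _) => apply: re_ball
  | H : re ?P |- re (fun z => ?P _) => apply: (re_comp H)
  | H : re ?P |- re ?P => exact: H
  | |- recursive _ => rec_step
  end.
Ltac re_tac := do ?re_step.

(** * Least fixed points of Horn clauses *)

(** A rule with a single premise fits this form by repeating the premise or by leaving the second
    one arbitrary. *)
Inductive derivable (Q0 : nat -> Prop) (Q2 : nat -> nat -> nat -> Prop) :
    nat -> Prop :=
  | Axm x of Q0 x : derivable Q0 Q2 x
  | Inf x y z of derivable Q0 Q2 y & derivable Q0 Q2 z & Q2 x y z :
      derivable Q0 Q2 x.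

(* A derivation is coded by a list of numbers each of which follows from members
   of its tail. *)
Lemma re_derivable Q0 Q2 :
  re Q0 -> re (fun w => Q2 (p1 w) (p1 (p2 w)) (p2 (p2 w))) ->
  re (derivable Q0 Q2).
Proof.
move=> re0 re2.
pose mem L x := exists i r, ldrop i L = (cpair x r).+1.
pose Q2p := (fun w => Q2 (p1 w) (p1 (p2 w)) (p2 (p2 w))).
pose just x r := Q0 x \/ exists y z, mem r y /\ mem r z /\ Q2p (cpair x (cpair y z)).
have memP s x : mem (lcode s) x <-> x \in s.
  split=> [[i [r]]|]; last first.
    elim: s => //= a s IHs; rewrite inE => /orP[/eqP->|/IHs[i [r ir]]].
      by exists 0, (lcode s).
    exists i.+1, r.
    by rewrite -[(cpair a _).+1]/(lcode (a :: s)) ldrop_lcode /= -ldrop_lcode.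
  rewrite ldrop_lcode; case def_s: (drop i s) => [|a t] //= -[/cpair_inj[<- _]].
  by rewrite -[s](cat_take_drop i) def_s mem_cat mem_head orbT.
have Q2E x y z : Q2p (cpair x (cpair y z)) = Q2 x y z by rewrite /Q2p !(p1K, p2K).
(* This expresses [trace] by quantifiers over numbers, to which the closure properties of [re]
   apply; [N] is the length of the list coded by [T]. *)
pose valid T := exists N, ldrop N T = 0 /\
  forall i, i < N -> exists x r, ldrop i T = (cpair x r).+1 /\ just x r.
apply: (@eq_re (fun x => exists T, valid (cpair x T).+1)); last first.
  by rewrite /valid /just /mem; re_tac.
pose fix trace s := if s is x :: r then just x (lcode r) /\ trace r else True.
have validE s : valid (lcode s) <-> trace s.
  elim: s => [|x s [IHs1 IHs2]]; first by split=> // _; exists 0.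
  have dropS i : ldrop i.+1 (lcode (x :: s)) = ldrop i (lcode s).
    by rewrite !ldrop_lcode.
  split=> [[[|N] [//]]|[xs /IHs2[N [N0 ltN]]]].
    rewrite dropS => N0 ltN; split.
      by have [_ [_ [[/cpair_inj[<- <-]] ?]]] := ltN 0 isT.
    by apply: IHs1; exists N; split=> // i /(ltN i.+1); rewrite dropS.
  exists N.+1; rewrite dropS; split=> // -[_|i lti].
    by exists x, (lcode s).
  by have := ltN i lti; rewrite -dropS.
(* Enlarging the tail of an entry keeps its premises available, so the derivations of two premises
   can be concatenated. *)
have trace_cat s s' : trace s -> trace s' -> trace (s ++ s').
  elim: s => //= x s IHs [xs /IHs ts] /ts{}ts; split=> //.
  case: xs => [|[y [z]]]; [by left | rewrite !memP => -[ys [zs qyz]]].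
  by right; exists y, z; rewrite !memP !mem_cat ys zs.
move=> x; split=> [[T]|].
  have [s ->] := lcode_surj T; rewrite -[_.+1]/(lcode (x :: s)) validE.
  suff sub s' : trace s' -> forall y, y \in s' -> derivable Q0 Q2 y.
    by move/sub; apply; rewrite mem_head.
  elim: s' => //= y s' IHs [ys /IHs{}IHs] w; rewrite inE => /orP[/eqP->|/IHs//].
  case: ys => [/Axm//|[a [b]]]; rewrite !memP Q2E => -[/IHs da [/IHs db]].
  exact: Inf.
suff: derivable Q0 Q2 x -> exists s, trace (x :: s).
  by move=> + dx => /(_ dx)[s ts]; exists (lcode s);
    rewrite -[_.+1]/(lcode (x :: s)) validE.
elim=> {}x => [q0|y z _ [s ts] _ [s' ts'] q2]; first by exists [::]; split=> //; left.
exists ((y :: s) ++ z :: s'); split; last exact: trace_cat.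
by right; exists y, z; rewrite !memP Q2E !(mem_cat, mem_head) orbT.
Qed.

(** * Uniform evaluation *)

(* <g, <n, m>> states that the algorithm numbered g maps n to m.  The tag 8 is
   not used by [godel]: <<8, f>, <n, m>> states that f is positive at <n, j> for all
   j < m.  Every number is a pair, so [eval_rule] can write <t, <f, g>> also
   when the argument of the tag is a single algorithm. *)
Definition eval_axiom z :=
  exists g n m, z = cpair g (cpair n m) /\
    (g = cpair 0 0 /\ m = 0 \/
     g = cpair 1 0 /\ m = n.+1 \/
     g = cpair 2 0 /\ (exists b, n = cpair m b) \/
     g = cpair 3 0 /\ (exists a, n = cpair a m) \/
     (exists f, g = cpair 8 f /\ m = 0)).

Definition eval_rule z z1 z2 :=
  exists t f g n m, z = cpair (cpair t (cpair f g)) (cpair n m) /\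
    (t = 4 /\ (exists a b, m = cpair a b /\
       z1 = cpair f (cpair n a) /\ z2 = cpair g (cpair n b)) \/
     t = 5 /\ (exists k,
       z1 = cpair g (cpair n k) /\ z2 = cpair f (cpair k m)) \/
     t = 6 /\ (exists a, n = cpair a 0 /\
       z1 = cpair f (cpair a m) /\ z2 = z1) \/
     t = 6 /\ (exists a k v, n = cpair a k.+1 /\
       z1 = cpair (cpair t (cpair f g)) (cpair (cpair a k) v) /\
       z2 = cpair g (cpair (cpair a (cpair k v)) m)) \/
     t = 7 /\
       z1 = cpair (cpair 8 (cpair f g)) (cpair n m) /\
       z2 = cpair (cpair f g) (cpair (cpair n m) 0) \/
     t = 8 /\ (exists j v, m = j.+1 /\
       z1 = cpair (cpair t (cpair f g)) (cpair n j) /\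
       z2 = cpair (cpair f g) (cpair (cpair n j) v.+1))).

Lemma re_eval : re (derivable eval_axiom eval_rule).
Proof. by apply: re_derivable; rewrite /eval_axiom /eval_rule; re_tac. Qed.

(** The induction is simultaneous because the rule for [Mu] has a premise with tag 8, and the rule
    for tag 8 has a premise about evaluation. *)
Lemma eval_sound z : derivable eval_axiom eval_rule z ->
  (forall c n m, z = cpair (godel c) (cpair n m) -> eval c n m) /\
  (forall c n m, z = cpair (cpair 8 (godel c)) (cpair n m) ->
     forall j, j < m -> exists v, eval c (cpair n j) v.+1).
Proof.
elim=> {}z.
  move=> [g [n [m [-> ax]]]]; split=> c n' m' /cpair_inj[eqg /cpair_inj[<- <-]].
    case: ax => [[e ax]|[[e ax]|[[e ax]|[[e ax]|[f [e _]]]]]]; rewrite {}e in eqg;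
    by case: c eqg => [||||c d|c d|c d|c] /= /cpair_inj[] // _ _.
  by move: ax; rewrite eqg => -[[/cpair_inj[]]|[[/cpair_inj[]]|[[/cpair_inj[]]|
    [[/cpair_inj[]]|[f [_ ->]]]]]].
move=> z1 z2 _ [ev1 mu1] _ [ev2 mu2] [t [f [g [n [m [-> rule]]]]]].
split=> c n' m' /cpair_inj[eqg /cpair_inj[<- <-]]; last first.
  have [eqt eqc] := cpair_inj eqg; subst t.
  case: rule => [[//]|[[//]|[[//]|[[//]|[[//]|[_ [j [v [-> [eq1 eq2]]]]]]]]]] i.
  rewrite ltnS leq_eqVlt => /orP[/eqP->|]; last by apply: mu1; rewrite eq1 eqc.
  by exists v; apply: ev2; rewrite eq2 eqc.
case: c eqg => [||||c d|c d|c d|c] /= /cpair_inj[eqt eqc]; subst t;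
  case: rule => [[// _ rule]|[[// _ rule]|[[// _ rule]|
    [[// _ rule]|[[// _ rule]|[// _ _]]]]]];
  try (have [eqf eqg] := cpair_inj eqc; subst f g).
- case: rule => [a [b [-> [/ev1 fa /ev2 gb]]]]; by exists a, b.
- case: rule => [k [/ev1 gk /ev2 fm]]; by exists k.
- case: rule => [a [-> [/ev1 fa _]]]; exists a, 0, (fun=> m); by split.
- case: rule => [a [k [v [-> [/(ev1 (Prec c d)) + /ev2 gm]]]]].
  move=> [a' [k' [s [/cpair_inj[<- <-] s0 sS eqv]]]].
  (* The value sequence up to [k] is extended by the new value [m]. *)
  exists a, k.+1, (fun j => if j == k.+1 then m else s j).
  split=> //=; last by rewrite eqxx.
  move=> j; rewrite ltnS eqSS leq_eqVlt => /orP[/eqP->|lt_jk].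
    by rewrite eqxx ltn_eqF // -eqv.
  by rewrite !ltn_eqF ?ltnS ?(ltnW lt_jk) //; exact: sS.
- case: rule => [eq1 eq2]; rewrite eqc in eq1 eq2; split; first exact: ev2 eq2.
  by move=> j; exact: mu1 eq1 j.
Qed.

Lemma eval_complete c n m : eval c n m ->
  derivable eval_axiom eval_rule (cpair (godel c) (cpair n m)).
Proof.
elim: c n m => [||||f IHf g IHg|f IHf g IHg|f IHf g IHg|f IHf] n m /= ev.
- apply: Axm; exists (cpair 0 0), n, m; split=> //; by left.
- apply: Axm; exists (cpair 1 0), n, m; split=> //; by right; left.
- apply: Axm; exists (cpair 2 0), n, m; split=> //; by do 2!right; left.
- apply: Axm; exists (cpair 3 0), n, m; split=> //; by do 3!right; left.
- have [a [b [/IHf fa /IHg gb ->]]] := ev.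
  apply: (Inf fa gb); exists 4, (godel f), (godel g), n, (cpair a b).
  by split=> //; left; split=> //; exists a, b.
- have [k /IHg gk /IHf fm] := ev.
  apply: (Inf gk fm); exists 5, (godel f), (godel g), n, m.
  by split=> //; right; left; split=> //; exists k.
- have [a [k [s [-> /IHf fs0 sS ->]]]] := ev.
  elim: k sS => [|k IHk] sS.
    apply: (Inf fs0 fs0); exists 6, (godel f), (godel g), (cpair a 0), (s 0).
    by split=> //; do 2!right; left; split=> //; exists a.
  have /IHg gS := sS k (leqnn _).
  have /IHk fgk : forall j, j < k -> eval g (cpair a (cpair j (s j))) (s j.+1).
    by move=> j /ltnW; apply: sS.
  apply: (Inf fgk gS); exists 6, (godel f), (godel g), (cpair a k.+1), (s k.+1).
  by split=> //; do 3!right; left; split=> //; exists a, k, (s k).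
- have [/IHf fm lt_m] := ev.
  (* The positivity of [f] below [m] is derived separately, by induction on [m] with tag 8. *)
  suff /Inf : derivable eval_axiom eval_rule (cpair (cpair 8 (godel f)) (cpair n m)).
    move=> /(_ _ _ fm); apply; exists 7, (p1 (godel f)), (p2 (godel f)), n, m.
    by rewrite p12K; split=> //; do 4!right; left.
  elim: m lt_m {ev fm} => [|m IHm] lt_m.
    apply: Axm; exists (cpair 8 (godel f)), n, 0; split=> //.
    by do 4!right; exists (godel f).
  have [v /IHf fv] := lt_m m (leqnn _).
  have /IHm mum : forall j, j < m -> exists v, eval f (cpair n j) v.+1.
    by move=> j /ltnW; apply: lt_m.
  apply: (Inf mum fv); exists 8, (p1 (godel f)), (p2 (godel f)), n, m.+1.
  by rewrite p12K; split=> //; do 5!right; split=> //; exists m, v.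
Qed.

Lemma evalE c n m :
  eval c n m <-> derivable eval_axiom eval_rule (cpair (godel c) (cpair n m)).
Proof.
split; first exact: eval_complete.
by move/eval_sound => [ev _]; exact: ev.
Qed.

Local Notation push a u := (cpair a u).+1.

(** * The word problem *)

(* <i, <r, <w, u>>> states that r w = u in the i-th group, for codes of words
   that need not be reduced. *)
Definition word_axiom (Rel : nat -> nat -> Prop) z :=
  exists i r w u, z = cpair i (cpair r (cpair w u)) /\
    (r = 0 /\ w = u \/ Rel i r /\ w = u \/
     r = 0 /\ exists j, w = push (j + j) (push (j + j).+1 u) \/
                        w = push (j + j).+1 (push (j + j) u)).

(** The first clause concatenates [r] and [w] letter by letter. The second says that the product is
    determined up to equality; symmetry, transitivity and congruence under [push] all follow from
    it. *)
Definition word_rule z z1 z2 :=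
  exists i r w u, z1 = cpair i (cpair r (cpair w u)) /\
    ((exists l, z = cpair i (cpair (push l r) (cpair w (push l u)))) \/
     (exists v, z2 = cpair i (cpair r (cpair w v)) /\
                z = cpair i (cpair 0 (cpair u v)))).

Definition word_eq Rel i r w u :=
  derivable (word_axiom Rel) word_rule (cpair i (cpair r (cpair w u))).

Lemma re_word Rel : re (fun z => Rel (p1 z) (p2 z)) ->
  re (derivable (word_axiom Rel) word_rule).
Proof.
move=> reRel; apply: re_derivable; rewrite /word_axiom /word_rule; last by re_tac.
have {}reRel f g : recursive f -> recursive g -> re (fun z => Rel (f z) (g z)).
  move=> rf rg; apply: eq_re (re_comp reRel (recursive_cpair rf rg)) => z.
  by rewrite p1K p2K.
do 4!apply: re_ex; apply: re_and; first by re_tac.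
apply: re_or; first by re_tac.
by apply: re_or; [apply: re_and; [apply: reRel|]|]; re_tac.
Qed.

Section WordRules.
Variables (Rel : nat -> nat -> Prop) (i : nat).
Local Notation W := (word_eq Rel i).
Local Notation "u ~~> v" := (W 0 u v) (at level 70).

Lemma word_refl w : w ~~> w.
Proof. by apply: Axm; exists i, 0, w, w; split=> //; left. Qed.

Lemma word_rel r w : Rel i r -> W r w w.
Proof. by move=> rr; apply: Axm; exists i, r, w, w; split=> //; right; left. Qed.

Lemma word_push l r w u : W r w u -> W (push l r) w (push l u).
Proof.
move=> d; apply: (Inf d (z := cpair i (cpair r (cpair w u)))) => //.
by exists i, r, w, u; split=> //; left; exists l.
Qed.

Lemma word_fun r w u v : W r w u -> W r w v -> u ~~> v.
Proof.
by move=> d e; apply: (Inf d e); exists i, r, w, u; split=> //; right; exists v.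
Qed.

Lemma word_sym u v : u ~~> v -> v ~~> u.
Proof. by move/word_fun; apply; exact: word_refl. Qed.

Lemma word_trans u v w : u ~~> v -> v ~~> w -> u ~~> w.
Proof. by move/word_sym/word_fun; apply. Qed.

Lemma word_congr l u v : u ~~> v -> push l u ~~> push l v.
Proof.
by move=> d; apply: word_fun (word_push l d); apply: word_push; exact: word_refl.
Qed.

Lemma word_cancel j (b : bool) w :
  push (j.*2 + b) (push (j.*2 + ~~ b) w) ~~> w.
Proof.
apply: Axm; exists i, 0, (push (j.*2 + b) (push (j.*2 + ~~ b) w)), w; split=> //.
by do 2!right; split=> //; exists j; case: b; [right | left];
  rewrite addn0 addn1 addnn.
Qed.

End WordRules.

Section WordProblem.
Variables (G : groupType) (k : nat) (x : 'I_k -> G).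
Local Open Scope group_scope.

Definition lift (s : seq ('I_k * bool)) : G :=
  foldr (fun a g => (if a.2 then x a.1 else (x a.1)^-1) * g) 1 s.

Lemma lift_lcat u w : lift (lcat u w) = lift u * lift w.
Proof.
elim: u => [|a u IHu] /=; first by rewrite mul1g.
rewrite -mulgA -{}IHu; case: (lcat u w) => //= b v.
case: eqP => // -> /=; case: a => j [] /=; by rewrite (mulKg, mulVKg).
Qed.

Lemma fgliftM u v : fglift x (u * v) = fglift x u * fglift x v.
Proof. exact: lift_lcat. Qed.

Lemma fgliftV u : fglift x u^-1 = (fglift x u)^-1.
Proof. by apply: (mulgI (fglift x u)); rewrite -fgliftM !mulgV. Qed.

(* The numbers 2 j and 2 j + 1 with j >= k are not letters and have value 1. *)
Definition letter_val l : G :=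
  if insub l./2 is Some j then if odd l then x j else (x j)^-1 else 1.

Definition word_val u : G :=
  foldr (fun l g => letter_val l * g) 1 (sval (cid (lcode_surj u))).

Lemma word_val_lcode s :
  word_val (lcode s) = foldr (fun l g => letter_val l * g) 1 s.
Proof. by rewrite /word_val; case: cid => t /= /lcode_inj->. Qed.

Lemma word_val0 : word_val 0 = 1.
Proof. exact: (word_val_lcode [::]). Qed.

Lemma word_val_push l u : word_val (push l u) = letter_val l * word_val u.
Proof.
by have [s ->] := lcode_surj u; rewrite -[_.+1]/(lcode (l :: s)) !word_val_lcode.
Qed.

Lemma letter_valE (j : 'I_k) (b : bool) :
  letter_val (j.*2 + b) = if b then x j else (x j)^-1.
Proof.
by rewrite /letter_val addnC half_bit_double valK oddD odd_double addbF; case: b.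
Qed.

Lemma letter_valK j : letter_val (j + j) * letter_val (j + j).+1 = 1 /\
  letter_val (j + j).+1 * letter_val (j + j) = 1.
Proof.
rewrite /letter_val addnn /= odd_double uphalf_double doubleK.
by case: insub => [y|] /=; rewrite ?mulg1 // mulVg mulgV.
Qed.

Lemma word_val_fgcode (w : freegroup k) : word_val (fgcode w) = fglift x w.
Proof.
rewrite /fgcode /fglift; elim: (fgword w) => [|a s IHs] /=; first exact: word_val0.
by rewrite word_val_push IHs letter_valE.
Qed.

(** The range of [fglift x] is a subgroup that contains [X]. *)
Lemma fglift_surj (X : {fset G}) :
  [set` X]%classic = range x -> generates [set` X]%classic ->
  forall g, exists w, fglift x w = g.
Proof.
move=> defX genX g; have : (setT : set G) g by [].
rewrite -genX => /(_ (range (fglift x))) [|w _ <-]; last by exists w.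
split.
  split.
  - by exists 1.
  - by move=> _ _ [u _ <-] [v _ <-]; exists (u * v); rewrite ?fgliftM.
  - by move=> _ [u _ <-]; exists u^-1; rewrite ?fgliftV.
rewrite defX => _ [j _ <-]; by exists (fggen j) => //; rewrite /fglift /= mulg1.
Qed.

Variables (R : set (freegroup k)) (Rel : nat -> nat -> Prop) (i : nat).
Hypothesis RelE : forall r, Rel i r <-> (@fgcode k @` R)%classic r.
Hypothesis kerE : normal_closure R = [set w | fglift x w = 1]%classic.
Local Notation "u ~~> v" := (word_eq Rel i 0 u v) (at level 70).

(** Every clause preserves the identity in [G]: relators have value 1 by [kerE], and the two letters
    of a cancelling pair have inverse values. *)
Lemma word_sound r w u :
  word_eq Rel i r w u -> word_val r * word_val w = word_val u.
Proof.
suff sound z : derivable (word_axiom Rel) word_rule z -> forall r w u,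
    z = cpair i (cpair r (cpair w u)) -> word_val r * word_val w = word_val u.
  by move/sound; apply.
elim=> {r w u}z.
  move=> [i' [r' [w' [u' [-> ax]]]]] r w u.
  move=> /cpair_inj[ei /cpair_inj[<- /cpair_inj[<- <-]]].
  case: ax => [[-> ->]|[[+ ->]|[-> [j jP]]]]; first by rewrite word_val0 mul1g.
    rewrite {}ei RelE => -[g Rg <-]; rewrite word_val_fgcode.
    have : normal_closure R g by move=> N [_]; apply.
    by rewrite kerE => ->; rewrite mul1g.
  rewrite word_val0 mul1g; have [l1 l2] := letter_valK j.
  by case: jP => ->; rewrite !word_val_push mulgA ?l1 ?l2 mul1g.
move=> z1 z2 _ IH1 _ IH2 [i' [r' [w' [u' [e1 rule]]]]] r w u.
case: rule => [[l ->]|[v [e2 ->]]].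
  move=> /cpair_inj[ei /cpair_inj[<- /cpair_inj[<- <-]]].
  by rewrite !word_val_push -mulgA (IH1 r' w' u') // e1 ei.
move=> /cpair_inj[ei /cpair_inj[<- /cpair_inj[<- <-]]].
by rewrite word_val0 mul1g -(IH1 r' w' u') -?(IH2 r' w' v) ?e1 ?e2 ?ei.
Qed.

Definition letter_num (a : 'I_k * bool) : nat := a.1.*2 + a.2.

(** The free reduction performed by [lcons] amounts to at most one cancellation. *)
Lemma word_lcons (a : 'I_k * bool) s :
  lcode (map letter_num (lcons a s)) ~~>
  push (letter_num a) (lcode (map letter_num s)).
Proof.
case: s => [|b s] /=; first exact: word_refl.
case: eqP => [->|_]; last exact: word_refl.
exact/word_sym/word_cancel.
Qed.

Lemma fgcodeE (w : freegroup k) :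
  fgcode w = lcode (map letter_num w).
Proof. by rewrite /fgcode; elim: (fgword w) => //= a s ->. Qed.

Lemma word_mull (g u v : freegroup k) :
  fgcode u ~~> fgcode v -> fgcode (g * u) ~~> fgcode (g * v).
Proof.
rewrite !fgcodeE /=; elim: (fgword g) => //= a s IHs /IHs{}IHs.
apply: word_trans (word_lcons _ _) _; apply/word_sym.
apply: word_trans (word_lcons _ _) _; exact/word_congr/word_sym.
Qed.

(** The product of a relator [g] with [u] is derivably both the concatenation and [u] itself, so
    [word_fun] identifies the two. *)
Lemma word_relator (g u : freegroup k) :
  R g -> fgcode (g * u) ~~> fgcode u.
Proof.
move=> Rg; have Wcat s t : word_eq Rel i (lcode s) (lcode t) (lcode (s ++ t)).
  by elim: s => [|l s IHs]; [exact: word_refl | exact: word_push].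
have Wlcat (s t : seq ('I_k * bool)) :
    lcode (map letter_num (lcat s t)) ~~>
    lcode (map letter_num (s ++ t)).
  elim: s => [|a s IHs] /=; first exact: word_refl.
  by apply: word_trans (word_lcons _ _) _; exact: word_congr.
rewrite !fgcodeE; apply: word_trans (Wlcat _ _) _; rewrite map_cat.
apply: word_fun (Wcat _ _) _; apply: word_rel.
by rewrite -fgcodeE; apply/RelE; exists g.
Qed.

(* The elements acting trivially on words modulo [~~>] form a normal subgroup. *)
Lemma word_complete (u v : freegroup k) :
  fglift x u = fglift x v -> fgcode u ~~> fgcode v.
Proof.
pose N : set (freegroup k) := fun g => forall w, fgcode (g * w) ~~> fgcode w.
have nN : normal_subgroup N.
  split; first split.
  - by move=> w; rewrite mul1g; exact: word_refl.
  - by move=> g h Ng Nh w; rewrite -mulgA; exact: word_trans (Ng _) (Nh w).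
  - by move=> g Ng w; have /word_sym := Ng (g^-1 * w); rewrite mulVKg.
  - move=> g h Ng w; rewrite conjgE -mulgA.
    have := word_mull h^-1 (Ng (h * w)).
    by rewrite mulKg !mulgA.
move=> eq_uv; have : normal_closure R (u^-1 * v).
  by rewrite kerE /= fgliftM fgliftV eq_uv mulVg.
have clN : (normal_closure R `<=` N)%classic.
  by apply: smallest_sub => // w Rw u'; exact: word_relator.
(* The triviality of [u^-1 * v] is applied to the empty word and multiplied by [u] on the left. *)
move=> /clN Nuv; have := word_mull u (Nuv 1).
by rewrite !mulg1 mulVKg => /word_sym.
Qed.

End WordProblem.

(** * Folner sets *)

Section Pushforward.
Variables (G : groupType) (m : nat) (h : 'I_m -> G).
Local Open Scope fset_scope.

Definition mult (g : G) : nat := \sum_(i < m) (h i == g).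
Definition supp : seq G := undup [seq h i | i : 'I_m].
(** Multiplicities vanish outside [supp], so this is the whole superlevel set of [mult]. *)
Definition level (s : nat) : {fset G} := [fset g in [seq g <- supp | s < mult g]].

Lemma mem_supp i : h i \in supp.
Proof. by rewrite mem_undup map_f ?mem_enum. Qed.

Lemma mult_supp g s : s < mult g -> g \in supp.
Proof.
case: (boolP (g \in supp)) => // g_supp; rewrite /mult big1 // => i _.
by case: eqP g_supp => // <-; rewrite mem_supp.
Qed.

Lemma in_level s g : (g \in level s) = (s < mult g).
Proof.
by rewrite inE mem_filter; case: ltnP => //= /mult_supp->.
Qed.

Lemma sum_supp i : \sum_(g <- supp) (h i == g) = 1.
Proof.
rewrite (eq_bigr (fun g => if pred1 (h i) g then 1 else 0)) => [|g _]; last first.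
  by rewrite /= eq_sym; case: eqP.
by rewrite -big_mkcond sum1_count count_uniq_mem ?undup_uniq // mem_supp.
Qed.

Lemma sum_mult (J : pred 'I_m) :
  \sum_(g <- supp) \sum_(i < m | J i) (h i == g) = #|J|.
Proof.
by rewrite exchange_big (eq_bigr (fun=> 1)) => [|i _]; rewrite ?sum1_card ?sum_supp.
Qed.

Lemma card_pred_supp (P : pred G) :
  #|` [fset g in [seq g <- supp | P g]]| = \sum_(g <- supp) P g.
Proof.
rewrite card_fseq undup_id ?filter_uniq ?undup_uniq // size_filter -sum1_count.
by rewrite big_mkcond; apply: eq_bigr => g _; case: (P g).
Qed.

(** The sum counts the thresholds [s] with [d <= s < c], cut off at [m]. *)
Lemma sum_level_gap c d : \sum_(s < m) ((s < c) && ~~ (s < d)) <= c - d.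
Proof.
suff -> : \sum_(s < m) ((s < c) && ~~ (s < d)) = minn m c - d by lia.
elim: m => [|p IHp]; first by rewrite big_ord0 min0n.
by rewrite big_ord_recr IHp /=; case: (ltnP p c); case: (ltnP p d) => /=; lia.
Qed.

(** Layer-cake formula: an element [g] lies in exactly [mult g] of the level sets, and the
    multiplicities add up to [m]. *)
Lemma sum_card_level : \sum_(s < m) #|` level s| = m.
Proof.
rewrite (eq_bigr _ (fun s _ => card_pred_supp _)) exchange_big /=.
rewrite (eq_bigr mult) => [|g _].
  by rewrite /mult sum_mult card_ord.
have le_mult : mult g <= m.
  rewrite -[leqRHS]card_ord -sum1_card; apply: leq_sum => i _; exact: leq_b1.
move: (mult g) le_mult => c; elim: m => [|p IHp]; first by rewrite big_ord0; case: c.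
rewrite leq_eqVlt big_ord_recr /= => /orP[/eqP->|].
  rewrite ltnSn addn1 (eq_bigr (fun=> 1)) => [|i _]; last by rewrite ltnS ltnW.
  by rewrite sum1_card card_ord.
by rewrite ltnS => le_cp; rewrite IHp // ltnNge le_cp addn0.
Qed.

Lemma card_level s : #|` level s| <= m.
Proof.
rewrite card_pred_supp; apply: (@leq_trans (size supp)).
  by rewrite -sum1_size; apply: leq_sum => g _; exact: leq_b1.
by rewrite (leq_trans (size_undup _)) // size_map size_enum_ord.
Qed.

(** The matching sends the matched indices over [g] injectively to indices over [y^-1 * g], so the
    multiplicity at [g] exceeds that at [y^-1 * g] by at most the number of unmatched indices over
    [g]. By the layer-cake formula the boundaries count exactly such excesses, and [m - q] indices
    are unmatched. *)
Lemma sum_level_boundary y q (a b : 'I_q -> 'I_m) :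
  injective a -> injective b -> (forall t, h (a t) = (y * h (b t))%g) ->
  \sum_(s < m) #|` level s `\` translate y (level s)| <= m - q.
Proof.
move=> inj_a inj_b hab.
pose J : {set 'I_m} := (a @: [set: 'I_q])%SET.
have mult_le g :
    mult g <= mult (y^-1 * g)%g + \sum_(i < m | i \notin J) (h i == g).
  rewrite {1}/mult (bigID (mem J)) /= leq_add2r big_imset /=; last exact: in2W.
  rewrite /mult (bigID (mem (b @: [set: 'I_q])%SET)) /= -[leqLHS]addn0 leq_add //.
  rewrite big_imset /=; last exact: in2W.
  by apply: leq_sum => t _; rewrite hab; case: eqP => // <-; rewrite mulKg eqxx.
apply: (@leq_trans (\sum_(s < m) \sum_(g <- supp)
    ((s < mult g) && ~~ (s < mult (y^-1 * g)%g)))).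
  apply: leq_sum => s _; rewrite -card_pred_supp; apply: fsubset_leq_card.
  apply/fsubsetP => g; rewrite inE in_level => /andP[ng lt_g].
  rewrite inE mem_filter lt_g (mult_supp lt_g) andbT /=; apply: contra ng => lt_yg.
  by apply/imfsetP; exists (y^-1 * g)%g; rewrite /= ?in_level ?mulVKg.
rewrite exchange_big /=; apply: (@leq_trans (\sum_(g <- supp)
    \sum_(i < m | i \notin J) (h i == g))).
  apply: leq_sum => g _; apply: leq_trans (sum_level_gap _ _) _.
  by rewrite leq_subLR.
rewrite sum_mult -[#|_|]/(#|[predC J]|) -(leq_add2l #|J|) cardC card_ord.
by rewrite card_imset // cardsT card_ord -leq_subLR.
Qed.

End Pushforward.

Import Order.TTheory GRing.Theory Num.Theory.

Section FolnerSets.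
Local Open Scope fset_scope.

Lemma folner_cardP (G : groupType) (X A : {fset G}) n : 0 < n ->
  folner_set X n A <->
  A != fset0 /\ forall x, x \in X -> n * #|` A `\` translate x A| <= #|` A|.
Proof.
move=> n_gt0; split=> -[A_neq0 AX]; split=> // x /AX;
  have A_gt0 : (0 < #|` A|%:R :> rat)%R by rewrite ltr0n cardfs_gt0.
all: rewrite ler_pdivrMr // mulrC ler_pdivlMr ?ltr0n // -natrM ler_nat mulnC //.
Qed.

(* The sizes of the level sets add up to m, and their boundaries along all the
   generators to less than m / n.+1. *)
Lemma folner_pushforward (G : groupType) (X : {fset G}) k (x : 'I_k -> G) n m
    (h : 'I_m -> G) :
  (forall g, g \in X -> exists j, g = x j) -> 0 < m ->
  (forall j, exists q (a b : 'I_q -> 'I_m),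
    [/\ injective a, injective b, forall t, h (a t) = (x j * h (b t))%g
      & n.+1 * k.+1 * (m - q) <= m]) ->
  exists A, [/\ A != fset0, #|` A| <= m &
    forall g, g \in X -> n.+1 * #|` A `\` translate g A| <= #|` A|].
Proof.
move=> Xx m_gt0 match_h; apply: contrapT => noA.
pose D j s := #|` level h s `\` translate (x j) (level h s)|.
(* A nonempty level set violating this bound would be the required [A], since each boundary is at
   most the sum over all generators. *)
have level_le s : #|` level h s| <= n.+1 * \sum_(j < k) D j s.
  have [-> | s_neq0] := eqVneq (level h s) fset0; first by rewrite cardfs0.
  rewrite leqNgt; apply/negP => lt_D; apply: noA; exists (level h s).
  split=> [//||g /Xx[j ->]]; first exact: card_level.
  by rewrite (leq_trans _ (ltnW lt_D)) // leq_mul2l (bigD1 j) //= leq_addr.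
have D_le j : n.+1 * k.+1 * \sum_(s < m) D j s <= m.
  have [q [a [b [inj_a inj_b hab le_q]]]] := match_h j.
  by apply: leq_trans le_q;
  rewrite leq_mul2l (sum_level_boundary inj_a inj_b hab) orbT.
have le_m : m <= n.+1 * \sum_(j < k) \sum_(s < m) D j s.
  rewrite -[leqLHS](sum_card_level h) exchange_big big_distrr.
  by apply: leq_sum => s _; exact: level_le.
have le_km : n.+1 * k.+1 * (\sum_(j < k) \sum_(s < m) D j s) <= k * m.
  rewrite -[k in leqRHS]card_ord -sum_nat_const big_distrr.
  by apply: leq_sum => j _; exact: D_le.
(* The factor [k.+1] in the hypothesis, instead of [k], makes this a contradiction and covers
   [k = 0]. *)
have : k.+1 * m <= k * m.
  by apply: leq_trans le_km; rewrite [n.+1 * _]mulnC -mulnA leq_mul2l.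
by rewrite leq_mul2r ltnn orbF -leqn0 leqNgt m_gt0.
Qed.

End FolnerSets.

(** * Certificates for Folner sets *)

(* W lists the words; a and b are the matching for x_j, q its size, and a', b'
   witness that a and b are injective. *)
Definition certificate (K : nat -> nat) Rel i n m := exists W, 0 < m /\
  forall j, j < K i -> exists q a b a' b', n.+1 * (K i).+1 * (m - q) <= m /\
    forall t, t < q -> lnth a t < m /\ lnth b t < m /\
      lnth a' (lnth a t) = t /\ lnth b' (lnth b t) = t /\
      word_eq Rel i 0 (lnth W (lnth a t))
        (cpair (j + j).+1 (lnth W (lnth b t))).+1.

Lemma re_certificate K Rel f g h :
  recursive K -> re (fun z => Rel (p1 z) (p2 z)) ->
  recursive f -> recursive g -> recursive h ->
  re (fun z => certificate K Rel (f z) (g z) (h z)).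
Proof.
move=> rK /re_word rW rf rg rh; rewrite /certificate /word_eq.
by re_tac.
Qed.

Section Certificates.
Variables (G : groupType) (X : {fset G}) (k : nat) (x : 'I_k -> G).
Variables (R : set (freegroup k)) (K : nat -> nat) (Rel : nat -> nat -> Prop) (i : nat).
Hypothesis memX : forall g, g \in X <-> exists j, g = x j.
Hypothesis surjx : forall g, exists w, fglift x w = g.
Hypothesis RelE : forall r, Rel i r <-> (@fgcode k @` R)%classic r.
Hypothesis kerE : normal_closure R = [set w | fglift x w = 1%g]%classic.
Hypothesis KE : K i = k.

Lemma certificate_sound n m : 0 < n ->
  certificate K Rel i n m -> le_fin (folner_fun X n) m.
Proof.
move=> n_gt0 [W [m_gt0 cert]].
pose h (t : 'I_m) := word_val x (lnth W t).
have [|//|j|A [A_neq0 leAm XA]] := @folner_pushforward G X k x n m h.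
- by move=> g /memX.
- have [|q [a [b [a' [b' [le_q ab]]]]]] := cert j; first by rewrite KE.
  rewrite KE in le_q.
  have ltam (t : 'I_q) : lnth a t < m by have [] := ab t (ltn_ord t).
  have ltbm (t : 'I_q) : lnth b t < m by have [_ []] := ab t (ltn_ord t).
  exists q, (fun t => Ordinal (ltam t)), (fun t => Ordinal (ltbm t)); split=> //.
  + move=> t u /(congr1 val) /= eq_tu; apply: val_inj; rewrite /=.
    have [_ [_ [<- _]]] := ab t (ltn_ord t).
    by have [_ [_ [<- _]]] := ab u (ltn_ord u); rewrite eq_tu.
  + move=> t u /(congr1 val) /= eq_tu; apply: val_inj; rewrite /=.
    have [_ [_ [_ [<- _]]]] := ab t (ltn_ord t).
    by have [_ [_ [_ [<- _]]]] := ab u (ltn_ord u); rewrite eq_tu.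
  + move=> t; rewrite /h /=;
    have [_ [_ [_ [_ /(word_sound RelE kerE)]]]] := ab t (ltn_ord t).
    by rewrite word_val0 mul1g word_val_push addnn -addn1 (letter_valE x j true).
have fA : folner_set X n A.
  apply/folner_cardP => //; split=> // g /XA; apply: leq_trans.
  by rewrite leq_mul2r leqnSn orbT.
rewrite /folner_fun; case: pselect => [e|[]]; last first.
  by exists #|` A|%fset; apply/asboolP; exists A.
rewrite /le_fin; case: ex_minnP => p _ /(_ #|` A|%fset) min_p.
by apply: leq_trans leAm; apply: min_p; apply/asboolP; exists A.
Qed.

(** The words represent the elements of a Folner set [A]. For a generator [x j], each [g] in both
    [A] and its translate is matched with [(x j)^-1 * g], so the unmatched indices correspond to the
    boundary of [A]. *)
Lemma certificate_complete n : amenable X -> exists m, certificate K Rel i n m.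
Proof.
(* This parameter is positive even for [n = 0] or [k = 0], so the search halts on every input. *)
move=> /(_ (n.+1 * k.+1) isT)[A /folner_cardP[//|A_neq0 XA]].
have /choice[w wE] := surjx.
pose e : seq G := A; have e_uniq : uniq e := fset_uniq A.
exists (size e), (lcode [seq fgcode (w g) | g <- e]); split.
  by rewrite -[size e]/#|` A|%fset cardfs_gt0.
rewrite KE => j0 lt_j0; pose j := Ordinal lt_j0.
pose s := [seq g <- e | g \in translate (x j) A].
have s_uniq : uniq s by rewrite filter_uniq.
have sA g : g \in s -> g \in e by rewrite mem_filter => /andP[].
have sxA g : g \in s -> ((x j)^-1 * g)%g \in e.
  by rewrite mem_filter => /andP[/imfsetP[g' /= Ag' ->] _]; rewrite mulKg.
(* Here [a] and [b] give the positions in [e] of the [t]-th matched element and of its partner,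
   while [a'] and [b'] lead from these positions back to [t]. *)
have [a aE] := lnth_mkseq (fun t => index (nth 1%g s t) e) (size s).
have [b bE] := lnth_mkseq (fun t => index ((x j)^-1 * nth 1 s t)%g e) (size s).
have [a' a'E] := lnth_mkseq (fun t => index (nth 1%g e t) s) (size e).
have [b' b'E] := lnth_mkseq (fun t => index (x j * nth 1 e t)%g s) (size e).
exists (size s), a, b, a', b'; split.
  apply: leq_trans (XA (x j) _); last by apply/memX; exists j.
  rewrite leq_mul2l; apply/orP; right.
  rewrite leq_subLR size_filter -(count_predC (mem (translate (x j) A)) e) leq_add2l.
  rewrite -size_filter -(undup_id (filter_uniq _ e_uniq)) -card_fseq.
  apply/fsubset_leq_card/fsubsetP => g; rewrite !inE mem_filter.
  exact.
move=> t lt_t; rewrite aE // bE //.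
have st := mem_nth 1%g lt_t; have [At xAt] := (sA _ st, sxA _ st).
rewrite !index_mem a'E ?index_mem // b'E ?index_mem // !nth_index // mulVKg.
rewrite index_uniq //.
do 4!split=> //; rewrite !lnth_lcode !(nth_map 1%g) ?index_mem // !nth_index //.
have push_j g :
    word_eq Rel i 0 (fgcode (fggen j * g)%g) (cpair (j0 + j0).+1 (fgcode g)).+1.
  have := word_lcons Rel i (j, true) g.
  by rewrite -[lcons _ _]/(fgword (fggen j * g)%g) -!fgcodeE /letter_num addn1 -addnn.
apply: word_trans (push_j _).
apply: (word_complete RelE kerE).
by rewrite fgliftM !wE /fglift /= mulg1 mulVKg.
Qed.

End Certificates.

(** * The canonical map to the quotient *)

Lemma ncpiM (G : groupType) (R : set G) u v :
  ncpi R (u * v)%g = (ncpi R u * ncpi R v)%g.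
Proof. by rewrite -[RHS]/(ncmul _ _) ncmulE. Qed.

Lemma ncpiV (G : groupType) (R : set G) u : ncpi R u^-1%g = (ncpi R u)^-1%g.
Proof. by rewrite -[RHS]/(ncinv _) /ncinv ncpi_inv. Qed.

Lemma fglift_ncpi k (R : set (freegroup k)) w :
  fglift (fun j => ncpi R (fggen j)) w = ncpi R w.
Proof.
case: w => s; elim: s => [|a s IHs] red_s; first by congr ncpi; apply: val_inj.
have rs := reduced_behead red_s.
(* In a reduced word, multiplying the tail by the first letter causes no cancellation. *)
have -> : FreeGroup red_s = (FreeGroup (isT : reduced [:: a]) * FreeGroup rs)%g.
  by apply: val_inj; rewrite /= -[RHS]/(lcat [:: a] s);
    case: s red_s {IHs rs} => //= b s /andP[/negbTE->].
rewrite fgliftM IHs ncpiM; congr (_ * _)%g.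
rewrite /fglift; case: a {red_s} => j [] /=.
  by rewrite mulg1; congr ncpi; apply: val_inj.
by rewrite mulg1 -ncpiV; congr ncpi; apply: val_inj.
Qed.

(** * Recursive bounds for one group and for a class of presentations *)

Lemma folner_fun_subrecursive (G : groupType) (X : {fset G}) k (x : 'I_k -> G) :
  [set` X]%classic = range x -> generates [set` X]%classic ->
  amenable X -> recursively_presentable x -> subrecursive (folner_fun X).
Proof.
move=> defX genX amX [R recR kerE].
(* A single presentation is treated as a constant family, used at the index 0. *)
pose Rel (_ r : nat) := (@fgcode k @` R)%classic r.
have reRel : re (fun z => Rel (p1 z) (p2 z)).
  apply: eq_re (re_eq (recursive_comp recR (recursive_p2 recursive_id))
    (recursive_const 1)) => z.
  by rewrite /Rel; case: asboolP.
have memX g : g \in X <-> exists j, g = x j.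
  split=> [gX|[j ->]].
    have : [set` X]%classic g by [].
    by rewrite defX => -[j _ <-]; exists j.
  have : range x (x j) by exists j.
  by rewrite -defX.
have surjx := fglift_surj defX genX.
have [g recg gP] := re_select
  (re_certificate (recursive_const k) reRel (recursive_const 0)
     (recursive_p1 recursive_id) (recursive_p2 recursive_id))
  (fun n => certificate_complete memX surjx (fun r => iff_refl _) kerE erefl n amX).
exists g => // n n_gt0.
by have := certificate_sound memX (fun r => iff_refl _) kerE erefl n_gt0 (gP n).
Qed.

Lemma mem_pgens (Q : presentation) g :
  g \in pgens Q <-> exists j, g = ncpi (@relators Q) (fggen j).
Proof.
split=> [/imfsetP[j _ ->]|[j ->]]; first by exists j.
by apply/imfsetP; exists j.
Qed.

Theorem theorem1 :
  (forall (G : groupType) (X : {fset G}) (k : nat) (x : 'I_k -> G),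
      injective x -> [set` X]%classic = range x ->
      generates [set` X]%classic ->
      amenable X ->
      recursively_presentable x ->
      subrecursive (folner_fun X))
  /\
  (forall P : nat -> presentation,
      effective_enumeration P ->
      forall C : set presentation,
      recursively_enumerable P C ->
      (forall Q, C Q -> amenable (pgens Q)) ->
      exists U : nat -> nat,
        [/\ recursive U,
            forall n, (0 < n)%N -> (0 < U n)%N
          & forall i, C (P i) ->
              exists N : nat, forall n, (0 < n)%N -> (N <= n)%N ->
                le_fin (folner_fun (pgens (P i)) n) (U n)]).
Proof.
split=> [G X k x _|P [_ recK [e rece relP]] C [A [c [f cf listA]] ->] amC].
  exact: folner_fun_subrecursive.
pose K i := ngen (P i).
(* The algorithm numbered [e i] prints [r] at stage [t] when its output is [r.+1]; uniform
   evaluation makes this enumerable in [i] and [r] jointly. *)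
pose Rel i r := exists t, derivable eval_axiom eval_rule (cpair (e i) (cpair t r.+1)).
have reRel : re (fun z => Rel (p1 z) (p2 z)).
  by have reE := re_eval; rewrite /Rel; re_tac.
have RelE i r : Rel i r <-> (@fgcode _ @` @relators (P i))%classic r.
  have [d dE [f' df' ->]] := relP i; rewrite /Rel -dE.
  split=> -[t]; exists t; first by apply/(computesP df'); apply/evalE.
  by apply/evalE/(computesP df').
have kerE i : normal_closure (@relators (P i)) =
    [set w | fglift (fun j => ncpi (@relators (P i)) (fggen j)) w = 1%g]%classic.
  apply/seteqP; split=> w /=; rewrite fglift_ncpi -[1%g]/(ncpi _ 1%g).
    move=> Nw; apply/esym/ncpiP; by rewrite invg1 mul1g.
  by move/esym/ncpiP; rewrite invg1 mul1g.
have surjP i g : exists w,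
    fglift (fun j => ncpi (@relators (P i)) (fggen j)) w = g.
  by exists (repr g); rewrite fglift_ncpi ncreprK.
(* [M] bounds the size of some certificate for each presentation listed before stage [n]; stages
   with output 0 print nothing and impose no condition. *)
pose S n M := 0 < M /\ forall t, t < n ->
  f t = 0 \/ exists a m, f t = a.+1 /\ certificate K Rel a n m /\ m <= M.
have recf : recursive f by exists c.
have reS : re (fun z => S (p1 z) (p2 z)).
  have reC := re_certificate recK reRel.
  rewrite /S; apply: re_and; first by re_tac.
  apply: re_ball; [|apply: re_or; [|do 2!apply: re_ex; apply: re_and;
    [|apply: re_and; [apply: reC|]]]]; by re_tac.
have exS n : exists M, S n M.
  have /choice[m mP] t : exists m, f t = 0 \/
      exists a, f t = a.+1 /\ certificate K Rel a n m.
    case ft: (f t) => [|a]; first by exists 0; left.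
    have Ca : (P @` A)%classic (P a) by exists a => //; apply/listA; exists t.
    have [m cert] := certificate_complete (@mem_pgens (P a)) (surjP a) (RelE a)
      (kerE a) (erefl (K a)) n (amC _ Ca).
    by exists m; right; exists a.
  (* The sum dominates every chosen size, and the successor makes it positive. *)
  exists (\sum_(t < n) m t).+1; split=> // t lt_tn.
  have [->|[a [ft cert]]] := mP t; [by left | right].
  exists a, (m t); split=> //; split=> //.
  by rewrite (bigD1 (Ordinal lt_tn)) //= leqW ?leq_addr.
have [U recU US] := re_select reS exS; exists U; split=> // [n _|i [a Aa <-]].
  by have [] := US n.
(* A presentation listed at stage [t] is taken into account by [U n] for every [n > t]. *)
have [t ft] := (listA a).1 Aa; exists t.+1 => n n_gt0 lt_tn.
have [_ /(_ t lt_tn)[|[b [m [+ [cert le_mU]]]]]] := US n; rewrite ft // => -[eq_ab].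
rewrite -{}eq_ab in cert.
have := certificate_sound (@mem_pgens (P a)) (RelE a) (kerE a) erefl n_gt0 cert.
by case: folner_fun => //= p le_pm; exact: leq_trans le_mU.
Qed.
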